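(* Let $f\colon P\to Q$ be a closed full map of finite posets, where $P$ is nonsingular. Then $f$ factors as a composition of closed full maps $f_i$ of posets such that each $f_i$ has only one non-degenerate point inverse.
   Context: For an element $p$ of a poset $P$ let $\lceil p\rceil=\lceil p\rceil_P=\{x\in P: x\le p\}$, the cone of $p$. A monotone map $f\colon P\to Q$ is closed if $f(\lceil p\rceil)=\lceil f(p)\rceil$ for every $p\in P$. A subposet $F$ of $P$ is full in $P$ if for every $p\in P$ the intersection $\lceil p\rceil_P\cap F$ is either empty or a cone $\lceil x\rceil_F$ of $F$. A monotone map $f\colon P\to Q$ is full if $f^{-1}(q)$ is full in $P$ for every $q\in Q$. A poset is nonsingular if it contains no interval $[a,b]=\{c: a\le c\le b\}$ of cardinality three. A point inverse of $f\colon P\to Q$ is a subposet $f^{-1}(q)$, $q\in Q$; it is degenerate if it is a singleton. ''Only one non-degenerate point inverse'' means that there is at most one element of the target of $f_i$ whose preimage under $f_i$ is not a singleton. *)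

(* Defs.v *)
From HB Require Import structures.
From mathcomp Require Import all_boot all_order.

Set Implicit Arguments.
Unset Strict Implicit.
Unset Printing Implicit Defensive.

Import Order.TTheory.
Local Open Scope order_scope.

Definition cone (d : Order.disp_t) (P : finPOrderType d) (p : P) : {set P} :=
  [set x | x <= p].

Definition fiber (d d' : Order.disp_t) (P : finPOrderType d)
    (Q : finPOrderType d') (f : P -> Q) (q : Q) : {set P} :=
  f @^-1: [set q].

Definition monotone (d d' : Order.disp_t) (P : finPOrderType d)
    (Q : finPOrderType d') (f : P -> Q) : Prop :=
  {homo f : x y / x <= y}.

Definition closed_map (d d' : Order.disp_t) (P : finPOrderType d)
    (Q : finPOrderType d') (f : P -> Q) : Prop :=
  monotone f /\ forall p : P, f @: cone p = cone (f p).

(* For x in F, the cone of x in the subposet F is cone x :&: F. *)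
Definition full_subposet (d : Order.disp_t) (P : finPOrderType d)
    (F : {set P}) : Prop :=
  forall p : P, cone p :&: F = set0 \/
    exists2 x : P, x \in F & cone p :&: F = cone x :&: F.

Definition full_map (d d' : Order.disp_t) (P : finPOrderType d)
    (Q : finPOrderType d') (f : P -> Q) : Prop :=
  monotone f /\ forall q : Q, full_subposet (fiber f q).

Definition nonsingular (d : Order.disp_t) (P : finPOrderType d) : Prop :=
  forall a b : P, #|[set c : P | a <= c <= b]| <> 3.

(* An empty point inverse is not a singleton, hence is not degenerate. *)
Definition degenerate (d d' : Order.disp_t) (P : finPOrderType d)
    (Q : finPOrderType d') (f : P -> Q) (q : Q) : Prop :=
  #|fiber f q| = 1.

Definition at_most_one_nondegenerate (d d' : Order.disp_t)
    (P : finPOrderType d) (Q : finPOrderType d') (f : P -> Q) : Prop :=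
  forall q q' : Q, ~ degenerate f q -> ~ degenerate f q' -> q = q'.

(* f = f_n \o ... \o f_1 for some n >= 1, finite posets P = P_0, ..., P_n = Q
   and maps f_i : P_(i-1) -> P_i all satisfying C. *)
Inductive composition_of
    (C : forall (d d' : Order.disp_t) (P : finPOrderType d)
           (Q : finPOrderType d'), (P -> Q) -> Prop)
    (d d' : Order.disp_t) (P : finPOrderType d) (Q : finPOrderType d')
    (f : P -> Q) : Prop :=
| composition_single of C d d' P Q f
| composition_step (e : Order.disp_t) (R : finPOrderType e)
    (g : P -> R) (h : R -> Q) of
    C d e P R g & composition_of C h & f =1 h \o g.

(* Main.v *)
Require Import Defs.
From HB Require Import structures.
From mathcomp Require Import all_boot all_order.

(** A lower set [D] of [Q] cuts a closed map [f : P -> Q] in two: first the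
    part of [f] over [D] is carried out, then the rest.  The intermediate poset
    is obtained from [P] by replacing the part of [P] over [D] by [D] itself.
    It lives inside the mapping cylinder of [f], which is the disjoint union of
    [P] and [Q] with the additional relations [q <= p] whenever [q <= f p];
    the subposet consists of [D] and of the points of [P] not over [D].

    Both maps [P -> splice] and [splice -> Q] are closed and full when [f] is
    ([collapse_closed], [collapse_full], [expand_closed], [expand_full]).
    Closedness of [f] is what makes the cylinder order the right one: if
    [q <= f p] then [p] dominates a point over [q], so each relation between
    [D] and [P] comes from a relation in [P].  Each point inverse of [f] occurs
    in exactly one of the two maps: over [D] in the first one, outside [D] in
    the second one, and all the other point inverses are singletons.

    Let [D] be the cone of a minimal point [q] of [Q] with non-degenerate point
    inverse.  The first map has a non-degenerate point inverse over [q] only,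
    and the second one has fewer such points than [f], so that induction on
    their number gives the factorization. *)

Set Implicit Arguments.
Unset Strict Implicit.
Unset Printing Implicit Defensive.

Import Order.TTheory.
Local Open Scope order_scope.

(** * Closed and full maps in terms of elements *)

Section Elementwise.
Context (d d' : Order.disp_t) (P : finPOrderType d) (Q : finPOrderType d').
Implicit Types (f : P -> Q) (F : {set P}).

Lemma in_fiber f q p : (p \in fiber f q) = (f p == q).
Proof. by rewrite !inE. Qed.

(** Closed maps are the monotone maps along which relations [q <= f p] lift to
    the source. *)
Lemma closed_mapP f :
  closed_map f <->
  monotone f /\ forall p q, q <= f p -> exists2 x, x <= p & f x = q.
Proof.
split=> -[f_mono f_lift]; split=> // p.
  move=> q le_q_fp; have: q \in f @: cone p by rewrite f_lift inE.
  by case/imsetP=> x; rewrite inE => le_xp ->; exists x.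
apply/setP=> q; rewrite inE; apply/imsetP/idP=> [[x + ->]|/f_lift[x le_xp <-]].
  by rewrite inE => /f_mono.
by exists x; rewrite ?inE.
Qed.

(** Fullness asks for a greatest element of [F] below each [p] that lies above
    some point of [F]; this form mentions no cone of the subposet [F]. *)
Lemma full_subposetP F :
  full_subposet F <->
  forall p y, y \in F -> y <= p ->
    exists x, [/\ x \in F, x <= p & forall z, z \in F -> z <= p -> z <= x].
Proof.
split=> [F_full p y Fy le_yp | F_top p].
  have [cone0|[x Fx cone_x]] := F_full p.
    by have := in_set0 y; rewrite -cone0 !inE Fy le_yp.
  exists x; split=> // [|z Fz le_zp].
    have: x \in cone x :&: F by rewrite !inE lexx.
    by rewrite -cone_x !inE => /andP[].
  have: z \in cone p :&: F by rewrite !inE le_zp.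
  by rewrite cone_x !inE => /andP[].
have [->|[y]] := set_0Vmem (cone p :&: F); first by left.
rewrite !inE => /andP[le_yp Fy]; right.
have [x [Fx le_xp x_max]] := F_top p y Fy le_yp; exists x => //.
apply/setP=> z; rewrite !inE; apply: andb_id2r => Fz.
by apply/idP/idP=> [/x_max->//|/le_trans]; apply.
Qed.

Lemma full_subposet_card1 F : #|F| = 1%N -> full_subposet F.
Proof.
move=> /eqP/cards1P[x ->]; apply/full_subposetP=> p y /set1P-> le_xp.
by exists x; split=> // [|z /set1P->]; rewrite ?set11.
Qed.

End Elementwise.

(** * Splicing a lower set of the target into the source *)

Section Splice.
Context (d d' : Order.disp_t) (P : finPOrderType d) (Q : finPOrderType d').
Context (f : P -> Q).

(** The monotonicity proof is a parameter of the type because transitivity of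
    the cylinder order rests on it. *)
Definition cylinder (f_mono : monotone f) : Type := (P + Q)%type.

Definition cylinder_le (u v : P + Q) : bool :=
  match u, v with
  | inl x, inl y => x <= y
  | inr q, inl y => q <= f y
  | inr q, inr r => q <= r
  | inl _, inr _ => false
  end.

Section Order.
Context (f_mono : monotone f).

Lemma cylinder_le_refl : reflexive cylinder_le.
Proof. by case=> x /=. Qed.

Lemma cylinder_le_anti : antisymmetric cylinder_le.
Proof.
by case=> [x|q] [y|r] //=; [move/le_anti-> | rewrite andbF | move/le_anti->].
Qed.

Lemma cylinder_le_trans : transitive cylinder_le.
Proof.
move=> [y|r] [x|q] [z|s] //=; try exact: le_trans.
by move=> le_q_fy /f_mono; exact: le_trans.
Qed.

HB.instance Definition _ := Finite.copy (cylinder f_mono) (P + Q)%type.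
HB.instance Definition _ := Order.Le_isPOrder.Build d (cylinder f_mono)
  cylinder_le_refl cylinder_le_anti cylinder_le_trans.

Definition in_splice (D : {set Q}) (u : cylinder f_mono) : bool :=
  match u with inl p => f p \notin D | inr q => q \in D end.

Definition splice (D : {set Q}) : Type := {u | in_splice D u}.

HB.instance Definition _ D := SubType.on (splice D).
HB.instance Definition _ D := Finite.on (splice D).
HB.instance Definition _ D := [SubChoice_isSubPOrder of splice D by <: with d].

End Order.

Context (f_closed : closed_map f) (D : {set Q}).
Context (D_lower : forall x y : Q, x <= y -> y \in D -> x \in D).
Let f_mono : monotone f := proj1 f_closed.
Let f_lift := proj2 (proj1 (closed_mapP f) f_closed).
Local Notation S := (splice f_mono D).
Implicit Types (r s : S).

Lemma le_spliceE r s : (r <= s) = cylinder_le (val r) (val s).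
Proof. by []. Qed.

Lemma collapse_subproof p :
  in_splice D ((if f p \in D then inr (f p) else inl p) : cylinder f_mono).
Proof. by case: (boolP (f p \in D)). Qed.

Definition collapse (p : P) : S := Sub _ (collapse_subproof p).

Definition expand (r : S) : Q :=
  match val r with inl p => f p | inr q => q end.

Lemma collapseK p : expand (collapse p) = f p.
Proof. by rewrite /expand /=; case: ifP. Qed.

Lemma val_collapse_in p : f p \in D -> val (collapse p) = inr (f p).
Proof. by move=> /= ->. Qed.

Lemma val_collapse_out p : f p \notin D -> val (collapse p) = inl p.
Proof. by move=> /= /negPf->. Qed.

Lemma fiber_collapse_inr r q : val r = inr q -> fiber collapse r = fiber f q.
Proof.
move=> r_q; have Dq: q \in D by have := valP r; rewrite r_q.
apply/setP=> p; rewrite !in_fiber -val_eqE r_q /=.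
case: ifP => [_|/negbT fpD]; first by [].
by apply/esym/negbTE; apply: contraNneq fpD => ->.
Qed.

Lemma fiber_collapse_inl r p : val r = inl p -> fiber collapse r = [set p].
Proof.
move=> r_p; have fpD: f p \notin D by have := valP r; rewrite r_p.
apply/setP=> x; rewrite in_fiber inE -val_eqE r_p /=.
case: ifP => [fxD|_]; last by [].
by apply/esym/negbTE; apply: contraTneq fxD => ->.
Qed.

(** A point [q] of [D] below [collapse p] satisfies [q <= f p], and this
    relation lifts along [f] to a point below [p] that is sent to [q]. *)
Lemma collapse_closed : closed_map collapse.
Proof.
apply/closed_mapP; split=> [x y le_xy|p r].
  have le_fxy := f_mono le_xy; rewrite le_spliceE.
  have [fyD|fyD] := boolP (f y \in D).
    by rewrite !val_collapse_in // (D_lower le_fxy).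
  rewrite (val_collapse_out fyD); have [fxD|fxD] := boolP (f x \in D).
    by rewrite val_collapse_in.
  by rewrite val_collapse_out.
case r_val: (val r) => [x|q]; rewrite le_spliceE r_val => le_rp.
  have fxD: f x \notin D by have := valP r; rewrite r_val.
  exists x; last by apply: val_inj; rewrite val_collapse_out.
  by move: le_rp => /=; case: ifP.
have Dq: q \in D by have := valP r; rewrite r_val.
have /f_lift[x le_xp fx]: q <= f p by move: le_rp => /=; case: ifP.
by exists x => //; apply: val_inj; rewrite val_collapse_in fx.
Qed.

Lemma collapse_full : full_map f -> full_map collapse.
Proof.
case=> _ f_full; split=> [|r]; first by case: collapse_closed.
case r_val: (val r) => [p|q]; last by rewrite (fiber_collapse_inr r_val).
by apply: full_subposet_card1; rewrite (fiber_collapse_inl r_val) cards1.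
Qed.

(** Outside [D] the point inverses of [expand] are copies of those of [f]. *)
Lemma fiber_expand q : q \notin D -> fiber expand q = collapse @: fiber f q.
Proof.
move=> qD; apply/setP=> r; apply/idP/imsetP=> [|[p + ->]]; last first.
  by rewrite !in_fiber collapseK.
rewrite in_fiber /expand; case r_val: (val r) => [p|s] /eqP r_q.
  exists p; first by rewrite in_fiber r_q.
  by apply: val_inj; rewrite val_collapse_out ?r_q.
by have := valP r; rewrite r_val /= r_q (negPf qD).
Qed.

Lemma card_fiber_expand q :
  #|fiber expand q| = if q \in D then 1%N else #|fiber f q|.
Proof.
case: ifPn => [Dq|qD].
  pose r : S := Sub (inr q : cylinder f_mono) Dq.
  rewrite -(cards1 r); congr #|pred_of_set _|; apply/setP=> s.
  rewrite in_fiber inE -val_eqE SubK /expand.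
  case s_val: (val s) => [p|t] //; apply/negbTE.
  by have := valP s; rewrite s_val /=; apply: contraNneq => ->.
rewrite fiber_expand // card_in_imset // => x y; rewrite !in_fiber.
move=> /eqP fx /eqP fy /(congr1 val).
by rewrite !val_collapse_out ?fx ?fy // => -[].
Qed.

(** A point of [D] below [expand r] already lies in the splice, below [r].  A
    point [q] outside [D] can only be below [expand r] when [r] comes from
    [P], because [D] is a lower set; then the lift along [f] is not collapsed. *)
Lemma expand_closed : closed_map expand.
Proof.
apply/closed_mapP; split=> [r s|r q].
  rewrite le_spliceE /expand.
  by case: (val r) (val s) => [x|t] [y|u] //= /f_mono.
rewrite /expand => le_qr; have [Dq|qD] := boolP (q \in D).
  exists (Sub (inr q : cylinder f_mono) Dq) => //.
  by rewrite le_spliceE SubK; case: (val r) le_qr.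
case r_val: (val r) le_qr => [p|s] le_qr; last first.
  by have := valP r; rewrite r_val /= => /(D_lower le_qr); rewrite (negPf qD).
have [x le_xp fx] := f_lift le_qr.
have x_val: val (collapse x) = inl x by rewrite val_collapse_out ?fx.
by exists (collapse x); rewrite ?le_spliceE ?x_val ?r_val.
Qed.

(** Outside [D] a point inverse is a copy of one of [f], and a point of the
    splice above it comes from [P], so greatest elements are found in [P]. *)
Lemma expand_full : full_map f -> full_map expand.
Proof.
case=> _ f_full; split=> [|q]; first by case: expand_closed.
have [Dq|qD] := boolP (q \in D).
  by apply: full_subposet_card1; rewrite card_fiber_expand Dq.
have val_q x : f x = q -> val (collapse x) = inl x.
  by move=> fx; rewrite val_collapse_out ?fx.
rewrite fiber_expand //; apply/full_subposetP=> r _ /imsetP[y fy ->].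
have f_y: f y = q by apply/eqP; rewrite -in_fiber.
rewrite le_spliceE (val_q y) //; case r_val: (val r) => [p|//] /= le_yp.
have [x [fx le_xp x_max]] := proj1 (full_subposetP _) (f_full q) p y fy le_yp.
have f_x: f x = q by apply/eqP; rewrite -in_fiber.
exists (collapse x); split; first exact: imset_f.
  by rewrite le_spliceE r_val val_q.
move=> _ /imsetP[z fz ->]; have f_z: f z = q by apply/eqP; rewrite -in_fiber.
by rewrite !le_spliceE r_val !val_q //; exact: x_max.
Qed.

End Splice.

(** * Splitting off one point inverse at a time *)

Definition nondegenerate_points (d d' : Order.disp_t) (P : finPOrderType d)
    (Q : finPOrderType d') (f : P -> Q) : {set Q} :=
  [set q | #|fiber f q| != 1%N].

Lemma finset_minimal (d : Order.disp_t) (Q : finPOrderType d) (A : {set Q}) :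
  A != set0 -> exists2 q, q \in A & forall x, x \in A -> x <= q -> x = q.
Proof.
case/set0Pn=> q0 Aq0.
case: (arg_minnP (fun q => #|cone q|) Aq0) => q Aq q_min.
exists q => // x Ax le_xq; apply: le_anti; rewrite le_xq /=.
have /eqP cone_eq: cone x == cone q.
  rewrite eqEcard q_min // andbT; apply/subsetP=> y; rewrite !inE => /le_trans.
  exact.
by move/setP/(_ q): cone_eq; rewrite !inE lexx.
Qed.

(** The induction is on the number of non-degenerate points, for all sources
    [P] at once, since the splice replaces [P] while [Q] stays the same. *)
Lemma factor_closed_full (d d' : Order.disp_t) (P : finPOrderType d)
    (Q : finPOrderType d') (f : P -> Q) :
  closed_map f -> full_map f ->
  composition_of
    (fun (e e' : Order.disp_t) (A : finPOrderType e) (B : finPOrderType e')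
         (g : A -> B) =>
       [/\ closed_map g, full_map g & at_most_one_nondegenerate g])
    f.
Proof.
have [n] := ubnP #|nondegenerate_points f|.
elim: n => // n IHn in d P f *; rewrite ltnS => le_fn f_closed f_full.
have [fib0|/finset_minimal[q]] := eqVneq (nondegenerate_points f) set0.
  apply: composition_single; split=> // q q' /eqP.
  by have := in_set0 q; rewrite -fib0 inE => /negbFE->.
rewrite inE => fib_q q_min.
have D_lower x y : x <= y -> y \in cone q -> x \in cone q.
  by rewrite !inE; exact: le_trans.
apply: (composition_step (g := collapse f_closed (cone q))
                         (h := @expand _ _ _ _ _ f_closed (cone q))).
- split; [exact: collapse_closed | exact: collapse_full | move=> r r'].
  (* The points of the splice coming from [P] are degenerate, and those of
     [cone q] other than [q] are so by minimality of [q]. *)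
  suff nondeg_val s : ~ degenerate (collapse f_closed (cone q)) s ->
      val s = inr q.
    by move=> /nondeg_val r_q /nondeg_val r'_q; apply: val_inj; rewrite r_q.
  rewrite /degenerate; case s_val: (val s) => [p|t].
    by rewrite (fiber_collapse_inl s_val) cards1.
  rewrite (fiber_collapse_inr s_val) => /eqP fib_t.
  have le_tq: t <= q by have := valP s; rewrite s_val /= inE.
  by rewrite (q_min t) ?inE.
- apply: IHn; last 2 first.
  + exact: expand_closed.
  + exact: expand_full.
  apply: leq_trans le_fn; apply: proper_card; apply/properP; split.
    apply/subsetP=> x; rewrite !inE card_fiber_expand; case: ifP => //.
  by exists q; rewrite !inE // card_fiber_expand inE lexx.
- by move=> p; rewrite /= collapseK.
Qed.

Theorem corollary9p9 (d d' : Order.disp_t)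
    (P : finPOrderType d) (Q : finPOrderType d') (f : P -> Q)
    (f_closed : closed_map f) (f_full : full_map f)
    (P_nonsingular : nonsingular P) :
  composition_of
    (fun (e e' : Order.disp_t) (A : finPOrderType e) (B : finPOrderType e')
         (g : A -> B) =>
       [/\ closed_map g, full_map g & at_most_one_nondegenerate g])
    f.
Proof. exact: factor_closed_full. Qed.
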